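(* Let $a$ and $\epsilon$ be real numbers with $0<\epsilon\leq\frac16-4\sqrt a$ (so in particular $a\ge 0$). There exists $\Delta(a)\geq 1$, depending only on $a$, such that the following holds. Let $D$ be a digraph with maximum degree $\Delta_{\max}(D)=\Delta\geq\Delta(a)$ satisfying $\overleftrightarrow{\omega}(D)\leq\frac23(\Delta+1)$, and let $v\in V(D)$ be such that $$\max(m^-(v),m^+(v))>(1-a)\Delta(\Delta-1).$$ Then $\vec{\chi}(D)\leq\max\bigl(\vec{\chi}(D-v),\,(1-\epsilon)(\Delta+1)\bigr)$.
   Context: Digraphs are finite, without loops and without parallel arcs (two opposite arcs $uv$ and $vu$ are allowed and form a digon). $N^+(v)$ and $N^-(v)$ are the out- and in-neighbourhoods of $v$, with sizes $d^+(v)$ and $d^-(v)$, and $\Delta_{\max}(D)=\max_{v\in V(D)}\max(d^+(v),d^-(v))$. For a vertex $v$, $m^+(v)$ and $m^-(v)$ denote the number of arcs of the subdigraph of $D$ induced by $N^+(v)$ and by $N^-(v)$, respectively. A biclique of $D$ is a set of vertices that are pairwise linked by two arcs in opposite directions; $\overleftrightarrow{\omega}(D)$ is the maximum size of a biclique. The dichromatic number $\vec{\chi}(D)$ is the least $k$ such that $V(D)$ can be partitioned into $k$ (possibly empty) sets each inducing an acyclic subdigraph of $D$ (a digon is a directed cycle of length 2). $D-v$ is $D$ with the vertex $v$ deleted. *)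

(* Defs.v *)
From HB Require Import structures.
From mathcomp Require Import all_boot all_order all_algebra.
From mathcomp Require Import boolp reals.

Set Implicit Arguments.
Unset Strict Implicit.
Unset Printing Implicit Defensive.

(* Digons are allowed: [arc] need not be antisymmetric. *)
Record digraph := Digraph {
  vertex :> finType;
  arc : rel vertex;
  arc_irr : irreflexive arc }.
Arguments arc {d}.

Definition out_nbrs (D : digraph) (v : D) : {set D} := [set w | arc v w].
Definition in_nbrs (D : digraph) (v : D) : {set D} := [set w | arc w v].

Definition max_degree (D : digraph) : nat :=
  \max_(v : D) maxn #|out_nbrs v| #|in_nbrs v|.

Lemma induced_irr (D : digraph) (S : {set D}) :
  irreflexive (fun x y : {x : D | x \in S} => arc (val x) (val y)).
Proof. by move=> x; exact: arc_irr. Qed.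

Definition induced (D : digraph) (S : {set D}) : digraph :=
  Digraph (@induced_irr D S).

Definition delete_vertex (D : digraph) (v : D) : digraph := induced [set~ v].

Definition num_arcs (D : digraph) : nat := #|[set p : D * D | arc p.1 p.2]|.

Definition m_out (D : digraph) (v : D) : nat := num_arcs (induced (out_nbrs v)).
Definition m_in (D : digraph) (v : D) : nat := num_arcs (induced (in_nbrs v)).

Definition biclique (D : digraph) (S : {set D}) : bool :=
  [forall x in S, forall y in S, (x != y) ==> arc x y && arc y x].

Definition biclique_number (D : digraph) : nat :=
  \max_(S : {set D} | biclique S) #|S|.

(* A directed cycle is a nonempty [ucycle]; since there are no loops, it has   *)
(* length at least 2, and length 2 means a digon.                             *)
Definition acyclic (D : digraph) : Prop :=
  forall c : seq D, ucycle arc c -> c = [::].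

(* The parts of the partition are the colour classes, some possibly empty. *)
Definition dicolorable (D : digraph) (k : nat) : Prop :=
  exists f : D -> 'I_k, forall i : 'I_k, acyclic (induced [set x | f x == i]).

Lemma dicolorable_exists (D : digraph) : exists k, `[< dicolorable D k >].
Proof.
exists #|D|; apply/asboolP; exists (@enum_rank D) => i c.
case: c => [|x c] // /andP[cyc _]; exfalso.
have eq_xy (y z : induced [set x | enum_rank x == i]) : y = z.
  apply/val_inj/enum_rank_inj.
  by move: (valP y) (valP z); rewrite !inE => /eqP-> /eqP->.
by case: c cyc => [|y c] /= /andP[]; rewrite -?(eq_xy x y) arc_irr.
Qed.

Definition dichromatic_number (D : digraph) : nat :=
  ex_minn (dicolorable_exists D).

(* Main.v *)
From mathcomp Require Import all_boot all_order all_algebra.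
From mathcomp Require Import boolp reals.
From mathcomp Require Import zify lra.
Require Import Defs.
Import Order.TTheory GRing.Theory Num.Theory.

(** Reversing all arcs exchanges in- and out-neighbourhoods and keeps the other
    parameters, so assume that N = N^+(v) spans more than (1-a)Delta(Delta-1)
    arcs, and put s = sqrt a.  Take k colours with k >= chi(D-v) and
    k + 1 > (1-eps)(Delta+1); an acyclic k-colouring of D - v has to be turned
    into one of D.

    Counting the arcs missing in N shows that, except for a set B of fewer than
    s*Delta vertices, every u in N sends at least (1-s)(Delta-1) arcs into N,
    hence at most s(Delta-1) + 1 arcs out of N ([few_sparse_vertices]).  Keep the
    old colours outside N and on B, and erase those of N minus B.

    All erased vertices are then coloured so that no coloured out-neighbour has
    the new colour: the new vertex is a sink of its colour class, and no
    monochromatic cycle appears ([acyclic_colouring_sink]).  Only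
    out-neighbours matter, so two vertices x, y without the arc yx may receive
    a common colour, x first and y next ([acyclic_colouring_pair]).  As long as
    the uncoloured part of N is not a biclique, it contains such a pair, and
    colours are plentiful because each vertex sees few colours outside N
    ([colour_nonadjacent_pairs]).  When this stops after e pairs, the uncoloured
    part is a biclique, so it has at most 2(Delta+1)/3 vertices, and e is at
    least Delta/6 up to a multiple of s*Delta.  From then on N carries at least e fewer colours than
    coloured vertices, which leaves a free colour for each remaining vertex of
    N ([colour_greedily]) and finally for v ([colour_last_vertex]).  The bound
    eps <= 1/6 - 4s is what makes these counts fit once s*Delta >= 1 and
    Delta >= 24, so for Delta >= 24 + 1/s when a > 0; for a = 0 no
    neighbourhood can be that dense. *)

Set Implicit Arguments.
Unset Strict Implicit.
Unset Printing Implicit Defensive.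

(** * Extending acyclic partial colourings by sinks *)

(** Partial colourings are total functions of which only the values on [S]
    count; this avoids colourings of varying induced subdigraphs. *)
Definition acyclic_colouring (D : digraph) (T : finType) (S : {set D})
    (f : D -> T) : Prop :=
  forall c : seq D, ucycle arc c -> {subset c <= S} ->
    {in c &, forall x y, f x = f y} -> c = [::].

Lemma acyclic_colouring_sub (D : digraph) (T : finType) (S S' : {set D})
    (f : D -> T) :
  S' \subset S -> acyclic_colouring S f -> acyclic_colouring S' f.
Proof.
move=> /subsetP sS' colf c cyc sc; apply: colf cyc _ => x /sc; exact: sS'.
Qed.

Definition recolour {D : digraph} {T : finType} (f : D -> T) (u : D) (i : T) :
    D -> T := fun x => if x == u then i else f x.

Lemma recolour_in (D : digraph) (T : finType) (S : {set D}) (f : D -> T) u i :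
  u \notin S -> {in S, recolour f u i =1 f}.
Proof. by move=> uS x xS; rewrite /recolour; case: eqP uS xS => // -> /negP. Qed.

(** A monochromatic cycle through [u] would leave [u] by an arc to an
    out-neighbour of colour [i] in [S], and there is none. *)
Lemma acyclic_colouring_sink (D : digraph) (T : finType) (S : {set D})
    (f : D -> T) u i :
  acyclic_colouring S f -> u \notin S ->
  i \notin f @: (out_nbrs u :&: S) ->
  acyclic_colouring (u |: S) (recolour f u i).
Proof.
move=> colf uS iN c /andP[cyc unc] sc mono.
case uc: (u \in c).
  have arcn := next_cycle cyc uc.
  have nc : next c u \in c by rewrite mem_next.
  have nu : next c u != u by apply: contraTneq arcn => ->; rewrite arc_irr.
  have nS : next c u \in S by have := sc _ nc; rewrite in_setU1 (negPf nu).
  case/negP: iN; apply/imsetP; exists (next c u); first by rewrite !inE arcn.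
  by have := mono _ _ uc nc; rewrite /recolour eqxx (negPf nu).
have cS : {subset c <= S}.
  move=> x xc; have := sc _ xc; rewrite in_setU1.
  by case: eqP => // exu; rewrite exu uc in xc.
have ucyc : ucycle arc c by apply/andP.
apply: (colf _ ucyc cS).
move=> x y xc yc; have := mono _ _ xc yc.
by rewrite !(recolour_in _ _ uS) ?cS.
Qed.

Lemma free_colour (T : finType) (A : {set T}) :
  #|A| < #|T| -> exists i, i \notin A.
Proof.
move=> ltAT; apply/existsP; apply: contraTT ltAT => /existsPn allA.
by rewrite -leqNgt -cardsT subset_leq_card //; apply/subsetP => x _;
   have := allA x; rewrite negbK.
Qed.

Lemma card_le_setU1 (T : finType) (A B : {set T}) i :
  A \subset i |: B -> #|A| <= #|B|.+1.
Proof.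
move/subset_leq_card/leq_trans; apply.
by rewrite cardsU1 -add1n leq_add2r leq_b1.
Qed.

Lemma recolour_imset (D : digraph) (T : finType) (S A : {set D}) (f : D -> T)
    u i :
  A \subset S -> u \notin S -> recolour f u i @: A = f @: A.
Proof.
move=> /subsetP sA uS; apply: eq_in_imset => x /sA; exact: recolour_in.
Qed.

(** The two ends of a missing arc can share a colour: [x] becomes a sink of its
    class, and then so does [y], since [x] is not an out-neighbour of [y].  The
    opposite arc from [x] to [y] may be present. *)
Lemma acyclic_colouring_pair (D : digraph) (T : finType) (S : {set D})
    (f : D -> T) x y i :
  acyclic_colouring S f -> x \notin S -> y \notin S -> x != y ->
  ~~ arc y x -> i \notin f @: ((out_nbrs x :|: out_nbrs y) :&: S) ->
  acyclic_colouring (y |: (x |: S)) (recolour (recolour f x i) y i).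
Proof.
move=> colf xS yS xy yx iN.
have sub (A : {set D}) :
    A \subset (out_nbrs x :|: out_nbrs y) -> i \notin f @: (A :&: S).
  by move=> sA; apply: contra iN; apply/subsetP/imsetS/setSI.
apply: acyclic_colouring_sink.
- by apply: acyclic_colouring_sink => //; apply/sub/subsetUl.
- by rewrite in_setU1 negb_or eq_sym xy.
have -> : out_nbrs y :&: (x |: S) = out_nbrs y :&: S.
  apply/setP => z; rewrite !inE; case: eqP => [->|//].
  by rewrite (negPf yx).
by rewrite (@recolour_imset _ _ S) ?subsetIr //; apply/sub/subsetUr.
Qed.

(** Bounds the colours seen by a set [A] of out-neighbours: outside [N] each of
    them may have its own colour, inside [N] the total number of colours used
    counts. *)
Lemma colours_le (D : digraph) (T : finType) (S A N : {set D}) (f : D -> T) :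
  #|f @: (A :&: S)| <= #|A :\: N| + #|f @: (N :&: S)|.
Proof.
apply: (@leq_trans #|f @: (A :\: N) :|: f @: (N :&: S)|).
  rewrite -imsetU subset_leq_card // imsetS //.
  by apply/subsetP => x; rewrite !inE; case: (x \in N); case: (x \in A).
by rewrite cardsU (leq_trans (leq_subr _ _)) // leq_add2r leq_imset_card.
Qed.

(** * Recolouring a neighbourhood *)

Lemma bicliquePn (D : digraph) (S : {set D}) :
  ~~ biclique S -> exists x y, [/\ x \in S, y \in S, x != y & ~~ arc y x].
Proof.
case/forallPn => x; rewrite negb_imply => /andP[xS /forallPn[y]].
rewrite !negb_imply => /andP[yS /andP[xy]]; rewrite negb_and.
by case/orP => n; [exists y, x | exists x, y]; rewrite ?(eq_sym y).
Qed.

(** The integer [e] counts the pairs coloured so far, starting from [b] coloured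
    vertices of [N].  A new pair brings two vertices and at most one colour into
    [N], so [e] is also a lower bound for the difference between coloured
    vertices and colours in [N].  The two vertices of a pair see at most [2 * t]
    colours outside [N] and [b + e] inside, and [2 * e + 2] is at most [#|N|] as
    they are uncoloured themselves: this is the origin of the numerical hypothesis.  The vertices outside [N] that
    are coloured at the end were coloured at the beginning. *)
Lemma colour_nonadjacent_pairs (D : digraph) (T : finType) (N : {set D}) b t :
  4 * t + 2 * b + #|N| <= 2 * #|T| ->
  forall (S : {set D}) (f : D -> T) e,
  acyclic_colouring S f ->
  {in N :\: S, forall u, #|out_nbrs u :\: N| <= t} ->
  #|N :&: S| = b + 2 * e -> #|f @: (N :&: S)| + e <= #|N :&: S| ->
  exists (S' : {set D}) (f' : D -> T) e',
    [/\ acyclic_colouring S' f', S \subset S', ~: N :&: S' \subset S,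
        biclique (N :\: S') & #|N :&: S'| = b + 2 * e' /\
        #|f' @: (N :&: S')| + e' <= #|N :&: S'| ].
Proof.
move=> hT S; have [n] := ubnP #|N :\: S|; elim: n S => // n IHn S ltn f e.
move=> colf ht cS cf; case: (boolP (biclique (N :\: S))) => [bic|nbic].
  by exists S, f, e; split; rewrite ?subsetIr.
have [x [y [xNS yNS xy yx]]] := bicliquePn nbic.
have [/setDP[xN xS] /setDP[yN yS]] := (xNS, yNS).
have yxS : y \notin x |: S by rewrite in_setU1 negb_or eq_sym xy.
pose S' := y |: (x |: S).
have NS' : N :&: S' = y |: (x |: (N :&: S)).
  by apply/setP => z; rewrite !inE; case: (z =P y) => [->|_] /=; rewrite ?yN //;
  case: (z =P x) => [->|_] /=; rewrite ?xN.
have cNS' : #|N :&: S'| = #|N :&: S| + 2.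
  rewrite NS' !cardsU1 !inE (negPf xS) (negPf yS) eq_sym (negPf xy) !andbF.
  by rewrite addnA addnC.
have leN : #|N :&: S'| <= #|N| by rewrite subset_leq_card ?subsetIl.
have [|i iN] := @free_colour _ (f @: ((out_nbrs x :|: out_nbrs y) :&: S)).
  have le1 := colours_le S (out_nbrs x :|: out_nbrs y) N f.
  have le2 : #|(out_nbrs x :|: out_nbrs y) :\: N| <= t + t.
    rewrite setDUl cardsU (leq_trans (leq_subr _ _)) //.
    by rewrite leq_add ?ht.
  by move: hT cS cf cNS' leN le1 le2; clear; lia.
have colf' := acyclic_colouring_pair colf xS yS xy yx iN.
have [||||S2 [f2 [e2 [c2 s2 s3 b2 p2]]]] := IHn S' _ _ e.+1 colf'.
- have: #|N :\: S'| < #|N :\: S|.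
    apply: proper_card; apply/properP; split; last first.
      by exists x => //; rewrite !inE eqxx !orbT.
    by apply: setDS; rewrite /S' setUA subsetUr.
  by move: ltn; clear; lia.
- by move=> u /setDP[uN uS]; apply: ht; rewrite inE uN andbT; apply: contra uS;
     rewrite !inE => ->; rewrite !orbT.
- by move: cS cNS'; clear; lia.
- have : recolour (recolour f x i) y i @: (N :&: S') \subset i |: f @: (N :&: S).
    rewrite NS'; apply/subsetP => _ /imsetP[z zin ->].
    move: zin; rewrite /recolour !in_setU1.
    case: eqP => [->|_] /=; first by rewrite eqxx.
    case: eqP => [->|_] /=; first by rewrite eqxx.
    by move=> zin; rewrite imset_f ?orbT.
  by move/card_le_setU1; move: cNS' cf; clear; lia.
exists S2, f2, e2; split=> //.
  by apply: subset_trans s2; rewrite /S' setUA subsetUr.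
apply/subsetP => z zin; have:= subsetP s3 _ zin; move: zin; rewrite !inE.
by case: (z =P y) => [->|_] /=; rewrite ?yN //;
  case: (z =P x) => [->|_] /=; rewrite ?xN.
Qed.

(** Colouring one more vertex of [N] adds at most one colour, so the surplus [e]
    of coloured vertices over colours in [N] never decreases.  An uncoloured
    vertex of [N] thus sees at most [#|N| - 1 - e] colours in [N] and [t]
    outside. *)
Lemma colour_greedily (D : digraph) (T : finType) (N : {set D}) t e :
  t + #|N| <= #|T| + e ->
  forall (S : {set D}) (f : D -> T),
  acyclic_colouring S f ->
  {in N :\: S, forall u, #|out_nbrs u :\: N| <= t} ->
  #|f @: (N :&: S)| + e <= #|N :&: S| ->
  exists f' : D -> T,
    acyclic_colouring (N :|: S) f' /\ #|f' @: N| + e <= #|N|.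
Proof.
move=> hT S; have [n] := ubnP #|N :\: S|; elim: n S => // n IHn S ltn f.
move=> colf ht cf; case: (set_0Vmem (N :\: S)) => [NS0|[u uNS]].
  have sNS : N \subset S by rewrite -setD_eq0 NS0.
  by exists f; rewrite (setUidPr sNS); rewrite (setIidPl sNS) in cf.
have /setDP[uN uS] := uNS.
have NS' : N :&: (u |: S) = u |: (N :&: S).
  by apply/setP => z; rewrite !inE; case: eqP => [->|_] //=; rewrite ?uN.
have cNS' : #|N :&: (u |: S)| = #|N :&: S| + 1.
  by rewrite NS' cardsU1 !inE (negPf uS) andbF /=; lia.
have leN : #|N :&: (u |: S)| <= #|N| by rewrite subset_leq_card ?subsetIl.
have [|i iN] := @free_colour _ (f @: (out_nbrs u :&: S)).
  have le1 := colours_le S (out_nbrs u) N f.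
  have le2 := ht _ uNS.
  lia.
have colf' := acyclic_colouring_sink colf uS iN.
have [|||f2 [c2 p2]] := IHn (u |: S) _ _ colf'.
- have: #|N :\: (u |: S)| < #|N :\: S|.
    apply: proper_card; apply/properP; split; last first.
      by exists u => //; rewrite !inE eqxx.
    by apply: setDS; rewrite subsetUr.
  lia.
- by move=> w /setDP[wN wS]; apply: ht; rewrite inE wN andbT; apply: contra wS;
     rewrite !inE => ->; rewrite !orbT.
- have : recolour f u i @: (N :&: (u |: S)) \subset i |: f @: (N :&: S).
    rewrite NS'; apply/subsetP => _ /imsetP[z zin ->].
    move: zin; rewrite /recolour !in_setU1.
    case: eqP => [->|_] /=; first by rewrite eqxx.
    by move=> zin; rewrite imset_f ?orbT.
  by move/card_le_setU1; move: cNS' cf; clear; lia.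
exists f2; split=> //; apply: acyclic_colouring_sub c2.
by apply/setUS/subsetUr.
Qed.

(** The colours of [out_nbrs v] are erased outside [B].  When the pairing ends,
    the uncoloured part of [out_nbrs v] is a biclique, whose size bounds the
    number [e] of pairs from below by
    [(#|out_nbrs v| - #|B| - biclique_number D) / 2]; the last hypothesis says
    that the greedy phase, and then [v], can afford this. *)
Lemma colour_last_vertex (D : digraph) (T : finType) (v : D) (B : {set D}) t
    (f : D -> T) :
  acyclic_colouring [set~ v] f -> B \subset out_nbrs v ->
  {in out_nbrs v :\: B, forall u, #|out_nbrs u :\: out_nbrs v| <= t} ->
  4 * t + 2 * #|B| + #|out_nbrs v| <= 2 * #|T| ->
  2 * t + #|out_nbrs v| + #|B| + biclique_number D < 2 * #|T| ->
  exists f' : D -> T, acyclic_colouring [set: D] f'.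
Proof.
set N := out_nbrs v => colf sBN ht h1 h2.
have vN : v \notin N by rewrite inE arc_irr.
(* [S0] is the set of vertices keeping their colours. *)
pose S0 := [set~ v] :\: (N :\: B).
have NS0 : N :&: S0 = B.
  apply/setP => x; rewrite in_setI in_setD in_setC1 in_setD negb_and negbK.
  case xB: (x \in B) => /=.
    by rewrite (subsetP sBN) //=; apply: contraNneq vN => <-; rewrite (subsetP sBN).
  by case: (x \in N).
have NDS0 : N :\: S0 = N :\: B by rewrite -[in RHS]NS0 setDIr setDv set0U.
have [||||S1 [f1 [e [c1 s1 s1N bic [cN1 cf1]]]]] :=
  @colour_nonadjacent_pairs _ T N #|B| t h1 S0 f 0.
- by apply: acyclic_colouring_sub colf; apply: subsetDl.
- by rewrite NDS0.
- by rewrite NS0 muln0 addn0.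
- by rewrite NS0 addn0 leq_imset_card.
have lew : #|N :\: S1| <= biclique_number D.
  exact: (@leq_bigmax_cond _ (@biclique D) (fun S : {set D} => #|S|)).
have cN := cardsID S1 N.
have [||f2 [c2 cf2]] := @colour_greedily _ T N t e _ S1 f1 c1 _ cf1.
- by move: h2 cN lew cN1; clear; lia.
- move=> u /setDP[uN uS1]; apply: ht; rewrite inE uN andbT.
  by apply: contra uS1; rewrite -NS0 => /setIP[_ /(subsetP s1)].
have vS : v \notin N :|: S1.
  rewrite in_setU negb_or vN; apply/negP => vS1.
  have /(subsetP s1N) : v \in ~: N :&: S1 by rewrite !inE vS1 arc_irr.
  by rewrite !inE eqxx andbF.
have [|i iN] := @free_colour _ (f2 @: (out_nbrs v :&: (N :|: S1))).
  have : #|f2 @: (out_nbrs v :&: (N :|: S1))| <= #|f2 @: N|.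
    by rewrite subset_leq_card // imsetS // subsetIl.
  by move: h2 cN lew cN1 cf2; clear; lia.
exists (recolour f2 v i).
apply: acyclic_colouring_sub (acyclic_colouring_sink c2 vS iN).
apply/subsetP => x _; rewrite in_setU1 in_setU; case: eqP => //= /eqP xv.
case xN: (x \in N) => //=; apply: (subsetP s1).
by rewrite in_setD in_setC1 xv in_setD xN andbF.
Qed.

(** * Sparse vertices of a dense set *)

Lemma num_arcs_induced (D : digraph) (A : {set D}) :
  num_arcs (induced A) = \sum_(u in A) #|out_nbrs u :&: A|.
Proof.
pose g (p : induced A * induced A) : D * D := (val p.1, val p.2).
have ginj : injective g.
  move=> [x y] [x' y'] e; congr pair; apply: val_inj.
    by have := congr1 fst e.
  by have := congr1 snd e.
rewrite /num_arcs -(card_imset _ ginj) -sum1_card.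
under [RHS]eq_bigr do rewrite -sum1_card.
rewrite pair_big_dep /=; apply: eq_bigl => -[x y] /=; rewrite !inE.
apply/imsetP/and3P => [[[x' y'] + [-> ->]]|[xA xy yA]].
  by rewrite inE => xy; split=> //; exact: valP.
by exists (Sub x xA, Sub y yA); rewrite ?inE.
Qed.

(** Each vertex of [N] sends at most [r - 1] arcs into [N], and a sparse one at
    least [s * (r - 1)] fewer, while fewer than [s ^+ 2 * r * (r - 1)] arcs are
    missing from the maximal total [r * (r - 1)].  The bound is left multiplied by [s], so that for [s = 0]
    it reads [0 < 0] and shows that the hypotheses are contradictory. *)
Lemma few_sparse_vertices (R : realFieldType) (D : digraph) (N : {set D})
    (s r : R) : (0 <= s -> 1 < r -> #|N|%:R <= r ->
  (1 - s ^+ 2) * r * (r - 1) < (num_arcs (induced N))%:R ->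
  s * #|[set u in N | #|out_nbrs u :&: N|%:R < (1 - s) * (r - 1)]|%:R
    < s ^+ 2 * r)%R.
Proof.
move=> s0 r1 Nr; rewrite num_arcs_induced natr_sum.
set B := [set u in N | _] => h.
have r1' : (0 < r - 1)%R by rewrite subr_gt0.
rewrite -(ltr_pM2r r1').
suff : (\sum_(u in N) #|out_nbrs u :&: N|%:R
   <= #|N|%:R * (r - 1) - s * #|B|%:R * (r - 1) :> R)%R.
  have : (#|N|%:R * (r - 1) <= r * (r - 1))%R by rewrite ler_pM2r.
  move: h; set x := (\sum_(_ in _) _)%R; set y := (#|N|%:R * _)%R.
  set z := (_ * #|B|%:R * _)%R; lra.
have -> : (s * #|B|%:R * (r - 1) = \sum_(u in N) (u \in B)%:R * (s * (r - 1)))%R.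
  rewrite -mulr_suml -natr_sum -big_mkcondr /= sum1_card.
  rewrite mulrAC mulrC; congr (_%:R * _)%R; apply: eq_card => u.
  by rewrite [RHS]unfold_in !inE andbA andbb.
rewrite mulr_natl -sumr_const -sumrB ler_sum // => u uN.
case uB: (u \in B).
  by move: uB; rewrite inE uN /= mul1r => /ltW; lra.
rewrite mul0r subr0 lerBrDr natr1 (le_trans _ Nr) // ler_nat.
rewrite -add1n (cardsD1 u N) uN leq_add2l subset_leq_card //.
apply/subsetP => w /setIP[uw wN]; rewrite in_setD1 wN andbT.
by apply: contraTneq uw => ->; rewrite inE arc_irr.
Qed.

(** The case of a dense out-neighbourhood: [colour_last_vertex] applies with [B]
    the set of sparse vertices and [t] the integer part of [s * (r - 1) + 1],
    where [r] is the maximum degree. *)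
Lemma dense_out_nbrs_colouring (R : realType) (s eps : R) (D : digraph) (v : D)
    (T : finType) (f : D -> T) :
  (0 <= s -> 0 < eps -> eps <= 1 / 6 - 4 * s ->
  24 + s^-1 <= (max_degree D)%:R ->
  (biclique_number D)%:R <= 2 / 3 * ((max_degree D)%:R + 1) :> R ->
  (1 - s ^+ 2) * (max_degree D)%:R * ((max_degree D)%:R - 1)
    < (m_out v)%:R ->
  (1 - eps) * ((max_degree D)%:R + 1) < #|T|%:R + 1 ->
  acyclic_colouring [set~ v] f ->
  exists f' : D -> T, acyclic_colouring [set: D] f')%R.
Proof.
move=> s0 eps0 epss Ds wD hm hT colf.
have degD (u : D) : (#|out_nbrs u|%:R <= (max_degree D)%:R :> R)%R.
  by rewrite ler_nat (bigop.bigmax_sup u) ?leq_maxl.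
move: hm; rewrite /m_out; set N := out_nbrs v => hm.
set r := (max_degree D)%:R%R in Ds wD hm hT degD *.
have si : (0 <= s^-1)%R by rewrite invr_ge0.
have r1 : (1 < r)%R by lra.
have := few_sparse_vertices s0 r1 (degD v) hm.
set B := [set u in N | _]; rewrite expr2 -mulrA => hB.
(* For s = 0 the inequality just obtained is absurd. *)
have sgt0 : (0 < s)%R.
  by rewrite lt_neqAle s0 andbT; apply: contraTneq hB => <-; rewrite !mul0r ltxx.
rewrite ltr_pM2l // in hB.
have sr : (1 <= s * r)%R.
  by rewrite mulrC -ler_pdivrMr // mul1r; lra.
set t := Num.truncn (s * (r - 1) + 1)%R.
have tle : (t%:R <= s * (r - 1) + 1)%R.
  by rewrite truncn_le // addr_ge0 // mulr_ge0 //; lra.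
have dN := degD v.
apply: (@colour_last_vertex D T v B t f colf) => [|u||].
- by apply/subsetP => u; rewrite inE => /andP[].
- rewrite -/N => /setDP[uN]; rewrite inE uN /= -leNgt => hu.
  rewrite truncn_ge_nat; last by rewrite addr_ge0 // mulr_ge0 //; lra.
  have := degD u; rewrite -(cardsID N) natrD; lra.
- have -> : 4 * t + 2 * #|B| + #|out_nbrs v| <= 2 * #|T|
    = (4 * t%:R + 2 * #|B|%:R + #|out_nbrs v|%:R <= 2 * #|T|%:R :> R)%R.
    by rewrite -!natrM -!natrD ler_nat.
  nra.
- have -> : 2 * t + #|out_nbrs v| + #|B| + biclique_number D < 2 * #|T|
    = (2 * t%:R + #|out_nbrs v|%:R + #|B|%:R + (biclique_number D)%:R
       < 2 * #|T|%:R :> R)%R.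
    by rewrite -!natrM -!natrD ltr_nat.
  nra.
Qed.

(** * Reversing all arcs *)

Lemma reverse_irr (D : digraph) : irreflexive (fun x y : D => arc y x).
Proof. by move=> x; exact: arc_irr. Qed.

Definition reverse (D : digraph) : digraph := Digraph (@reverse_irr D).

Lemma max_degree_reverse (D : digraph) : max_degree (reverse D) = max_degree D.
Proof. by apply: eq_bigr => u _; rewrite maxnC. Qed.

Lemma biclique_number_reverse (D : digraph) :
  biclique_number (reverse D) = biclique_number D.
Proof.
apply: eq_bigl => S; apply: eq_forallb => x; congr (_ ==> _).
by apply: eq_forallb => y; rewrite andbC.
Qed.

Lemma m_out_reverse (D : digraph) (v : D) :
  @m_out (reverse D) v = m_in v.
Proof.
pose G := induced (in_nbrs v).
pose sw (p : G * G) := (p.2, p.1).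
have swinj : injective sw by case=> [x y] [x' y'] [-> ->].
rewrite /m_in /num_arcs -(card_imset _ swinj).
apply: eq_card => -[x y]; rewrite inE; apply/idP/imsetP => [xy|[[x' y'] + [-> ->]]].
  by exists (y, x); rewrite ?inE.
by rewrite inE.
Qed.

Lemma acyclic_colouring_reverse (D : digraph) (T : finType) (S : {set D})
    (f : D -> T) :
  acyclic_colouring S f -> @acyclic_colouring (reverse D) T S f.
Proof.
move=> colf c /andP[cyc unc] sc mono; apply: (can_inj revK).
apply: colf => [|x|x y]; rewrite ?mem_rev; [|exact: sc|exact: mono].
by rewrite /ucycle rev_uniq unc andbT rev_cycle.
Qed.

(** * Acyclic colourings and the dichromatic number *)

Lemma ucycle_induced (D : digraph) (A : {set D}) (c : seq (induced A)) :
  ucycle arc (map (val : induced A -> D) c) = ucycle arc c.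
Proof. by rewrite /ucycle cycle_map map_inj_uniq //; exact: val_inj. Qed.

Lemma lift_ucycle (D : digraph) (A : {set D}) (c : seq D) :
  {subset c <= A} -> ucycle arc c ->
  exists2 c' : seq (induced A), map val c' = c & ucycle arc c'.
Proof.
move=> sc ucy.
have [c' def_c] : exists c' : seq (induced A), map val c' = c.
  elim: c sc {ucy} => [|x c IHc] sc; first by exists [::].
  have [|c' <-] := IHc; first by move=> y yc; apply: sc; rewrite inE yc orbT.
  by exists (Sub x (sc _ (mem_head _ _)) :: c').
by exists c' => //; rewrite -def_c ucycle_induced in ucy.
Qed.

Lemma dicolorable_delete_vertex (D : digraph) (v : D) k K :
  dicolorable (delete_vertex v) k -> k <= K.+1 ->
  exists f : D -> 'I_K.+1, acyclic_colouring [set~ v] f.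
Proof.
move=> [f0 acyc] kK.
pose f x := if insub x is Some y then widen_ord kK (f0 y) else ord0.
have fE (y : delete_vertex v) : f (val y) = widen_ord kK (f0 y) by rewrite /f valK.
exists f => c ucy sc mono.
have [c1 def_c uc1] := lift_ucycle sc ucy.
case: c1 def_c uc1 => [<-//|x c1] def_c uc1.
have [|c2 def_c1 uc2] := @lift_ucycle _ [set y | f0 y == f0 x] _ _ uc1.
  move=> y yc; rewrite inE -val_eqE /=; apply/eqP.
  have : f (val y) = f (val x).
    by apply: mono; rewrite -def_c map_f // mem_head.
  by rewrite !fE => /(congr1 val).
by move: def_c1; rewrite (acyc _ _ uc2).
Qed.

Lemma acyclic_colouring_dicolorable (D : digraph) k (f : D -> 'I_k) :
  acyclic_colouring [set: D] f -> dicolorable D k.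
Proof.
move=> colf; exists f => i c ucy.
apply: (inj_map val_inj); apply: colf => [|x|].
- by rewrite ucycle_induced.
- by rewrite inE.
move=> _ _ /mapP[x _ ->] /mapP[y _ ->].
by move: (valP x) (valP y); rewrite !inE => /eqP-> /eqP->.
Qed.

Unset Implicit Arguments.
Local Open Scope ring_scope.

Theorem theorem1p10 (R : realType) (a : R) (ha : 0 <= a) :
  exists Delta_a : R, 1 <= Delta_a /\
    forall (eps : R), 0 < eps -> eps <= 1 / 6 - 4 * Num.sqrt a ->
    forall (D : digraph) (v : D),
      Delta_a <= (max_degree D)%:R ->
      (biclique_number D)%:R <= 2 / 3 * ((max_degree D)%:R + 1) :> R ->
      (1 - a) * (max_degree D)%:R * ((max_degree D)%:R - 1)
        < (maxn (m_in v) (m_out v))%:R ->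
      (dichromatic_number D)%:R
        <= Num.max (dichromatic_number (delete_vertex v))%:R
             ((1 - eps) * ((max_degree D)%:R + 1)).
Proof.
have s0 := sqrtr_ge0 a; have si : 0 <= (Num.sqrt a)^-1 by rewrite invr_ge0.
exists (24 + (Num.sqrt a)^-1); split; first by lra.
move=> eps eps0 epss D v Ds wD hm; rewrite leNgt gt_max; apply/negP.
rewrite ltr_nat => /andP[].
rewrite /dichromatic_number; case: ex_minnP => k' /asboolP colDv _.
case: ex_minnP => k _ minD k'k hk.
case: k k'k hk minD => [//|[|K]] k'k hk minD.
  have : 5 / 6 * 25 <= (1 - eps) * ((max_degree D)%:R + 1).
    by apply: ler_pM; lra.
  by move=> /le_lt_trans/(_ hk); lra.
have [f colf] := dicolorable_delete_vertex colDv k'k.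
suff [f' colf'] : exists f' : D -> 'I_K.+1, acyclic_colouring [set: D] f'.
  have /asboolP/minD := acyclic_colouring_dicolorable colf'.
  by rewrite ltnn.
rewrite -[a in 1 - a](sqr_sqrtr ha) in hm.
have hT : (1 - eps) * ((max_degree D)%:R + 1) < #|'I_K.+1|%:R + 1.
  by rewrite card_ord [_ + 1 in ltRHS]natr1.
move: hm; rewrite /maxn; case: ifP => _ hm.
  exact: (dense_out_nbrs_colouring s0 eps0 epss Ds wD hm hT colf).
have [|||||f' colf'] := @dense_out_nbrs_colouring _ _ _ (reverse D) v _ f s0 eps0 epss.
- by rewrite max_degree_reverse.
- by rewrite max_degree_reverse biclique_number_reverse.
- by rewrite max_degree_reverse m_out_reverse.
- by rewrite max_degree_reverse.
- exact: acyclic_colouring_reverse.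
by exists f'; exact: (@acyclic_colouring_reverse (reverse D)).
Qed.
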